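(* Let $G=(V,E)$ be a finite, connected graph cellularly embedded on a closed, orientable surface $\Sigma$ of genus $g$. Let $\mathcal P\subseteq \mathrm{GF}(2)^{|E|}$ be the subspace generated by the vectors of the components of the medial graph of $G$, let $\varphi:U^\perp\to H_1(\Sigma,\mathrm{GF}(2))$ be the homology map on the cycle space $U^\perp$ of $G$, and let $b=\dim\ker(\varphi|_{\mathcal P})$. Then the number of equivalence classes in the color changing game for $G$ on $\Sigma$ is $2^{2g+b}$.
   Context: $\mathrm{GF}(2)=\mathbb Z/2\mathbb Z$. Graphs may have loops and multiple edges; $\Sigma$ is connected. Cellularly embedded means every face is an open disk. Color changing game: an edge bicoloring is an arbitrary function from $E$ to a set of two colors. Two bicolorings are equivalent if one can be obtained from the other by a finite sequence of the following moves: (1) around a vertex, switch the colors of all edges with exactly one endpoint at that vertex (all non-loops adjacent to the vertex); (2) around a face of the embedded graph, switch the colors of all edges appearing exactly once in the boundary cycle of the face. Spaces: let $G^*=(V^*,E^* )$ be the dual graph of $G$ on $\Sigma$. Fix an ordering of $E$ and the induced ordering of $E^*$ via the bijection between edges and dual edges, so that subsets of $E$ and of $E^*$ are identified with vectors in $\mathrm{GF}(2)^{|E|}$. The cocycle space $U\subseteq\mathrm{GF}(2)^{|E|}$ of $G$ is the row space of the incidence matrix of $G$ over $\mathrm{GF}(2)$ (the row of a vertex has a $1$ exactly at the non-loop edges incident to it), and the cycle space $U^\perp$ of $G$ is its orthogonal complement with respect to the standard inner product $\langle\cdot,\cdot\rangle$. The map $\varphi$: choose a spanning tree $T$ of $G$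 and a spanning tree $C$ of $G^*$ such that no edge of $C$ is dual to an edge of $T$. There are exactly $2g$ edges $e_1^*,\dots,e_{2g}^*$ of $G^*$ that are neither in $C$ nor dual to edges of $T$. For $j=1,\dots,2g$ let $p_j\in\mathrm{GF}(2)^{|E|}$ be the vector of the unique cycle in $C\cup e_j^*$. With $H_1(\Sigma,\mathrm{GF}(2))$ identified with $\mathrm{GF}(2)^{2g}$, the map $\varphi$ is given by $\varphi(u)=(\langle p_1,u\rangle,\dots,\langle p_{2g},u\rangle)$ for $u\in U^\perp$; it sends a cycle of $G$ to its homology class in $\Sigma$. The space $\mathcal P$: the medial graph of $G$ is the 4-valent graph on $\Sigma$ with one vertex at the midpoint of each edge of $G$ and, for each corner of a face (a pair of consecutive edge-ends around a vertex), one arc joining the midpoints of the two edges meeting at that corner (if $G$ is a single vertex without edges, it is one circle). Its components $k_1,\dots,k_c$ are the closed curves traced out by going straight ahead (leaving along the opposite arc) at every vertex of the medial graph. The vector $v_i\in\mathrm{GF}(2)^{|E|}$ has a $1$ in the position of an edge $e$ if and only if $k_i$ passes through the midpoint of $e$ an odd number of times, i.e. exactly once. $\mathcal P$ is the span of $v_1,\dots,v_c$; it is contained in $U^\perp$. *)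

(* Defs.v *)
From mathcomp Require Import all_boot all_order all_fingroup all_algebra.

Set Implicit Arguments.
Unset Strict Implicit.
Unset Printing Implicit Defensive.

Import GRing.Theory.
Local Open Scope ring_scope.

(* A finite multigraph: every edge e has two ends, the darts (e, false) and
   (e, true), each attached to a vertex; loops and parallel edges are allowed. *)
Record graph := Graph {
  vertex : finType;
  edge : finType;
  endpt : edge * bool -> vertex
}.

Definition dart (G : graph) : finType := (edge G * bool)%type.

Definition rev (G : graph) (d : dart G) : dart G := (d.1, ~~ d.2).

Lemma rev_inj (G : graph) : injective (@rev G).
Proof. by case=> [e b] [e' b'] [-> /negb_inj ->]. Qed.

Definition rev_perm (G : graph) : {perm dart G} := perm (@rev_inj G).

(* GF(2)^E, with coordinates indexed by the edges themselves. *)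
Notation edge_space G := {ffun edge G -> ('F_2)^o}.

Section Graphs.
Variable G : graph.

Definition adj (A : {set edge G}) : rel (vertex G) := fun x y =>
  [exists d : dart G, [&& d.1 \in A, endpt d == x & endpt (rev d) == y]].

Definition connected : bool := n_comp (adj setT) (vertex G) == 1%N.

(* Edge sets of cycles: nonempty connected 2-regular subgraphs; a loop contributes 2 to the degree of its vertex. *)
Definition is_cycle (Z : {set edge G}) : bool :=
  [&& Z != set0,
      [forall x, #|[set d : dart G | (d.1 \in Z) && (endpt d == x)]|
                   \in [:: 0%N; 2%N]] &
      [forall d : dart G, forall d' : dart G,
         (d.1 \in Z) && (d'.1 \in Z) ==>
           connect (adj Z) (endpt d) (endpt d')]].

Definition spanning_tree (A : {set edge G}) : bool :=
  (n_comp (adj A) (vertex G) == 1%N) &&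
  [forall Z : {set edge G}, (Z \subset A) ==> ~~ is_cycle Z].

Definition ends_once (x : vertex G) (e : edge G) : bool :=
  #|[set b : bool | endpt (e, b) == x]| == 1%N.

Definition dot (u w : edge_space G) : 'F_2 := \sum_e u e * w e.

Definition char_vec (A : {set edge G}) : edge_space G := [ffun e => (e \in A)%:R].

Definition orthv (U : {vspace edge_space G}) : {vspace edge_space G} :=
  (\bigcap_(w : edge_space G | w \in U)
     lker (linfun (dot w : edge_space G -> ('F_2)^o)))%VS.

Definition incidence_row (x : vertex G) : edge_space G :=
  [ffun e => (ends_once x e)%:R].

Definition cocycle_space : {vspace edge_space G} :=
  <<[seq incidence_row x | x : vertex G]>>%VS.

Definition cycle_space : {vspace edge_space G} := orthv cocycle_space.

Definition bicoloring : finType := {ffun edge G -> bool}.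

Definition switch (x : vertex G) (c : bicoloring) : bicoloring :=
  [ffun e => c e (+) ends_once x e].

End Graphs.

(* A cellular embedding of a connected graph in a closed oriented surface, up to
   orientation-preserving homeomorphism, is the same thing as a rotation system
   (Heffter, Edmonds): [rot] sends each dart to the next one in counterclockwise
   order around its vertex. *)
Record rotation_system (G : graph) := RotationSystem {
  rot : {perm dart G};
  rotP : forall d d' : dart G,
    (endpt d == endpt d') = (d' \in porbit rot d)
}.

Section Embedding.
Variables (G : graph) (R : rotation_system G).

(* Leave along d, arrive at the other end, turn to the next dart there. *)
Definition face_perm : {perm dart G} := (rev_perm G * rot R)%g.

(* A face is given by the darts along which its boundary is traversed.  The
   one-vertex graph without edges has one face (on the sphere), whose boundary
   contains no dart. *)
Definition faces : {set {set dart G}} :=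
  if #|edge G| == 0%N then [set set0] else porbits face_perm.

Definition face : finType := {A : {set dart G} | A \in faces}.

Lemma porbit_faces (d : dart G) : porbit face_perm d \in faces.
Proof.
rewrite /faces; case: eqP => [E0|_]; last exact: imset_f.
by have := fintype0 d.1 E0.
Qed.

Definition face_of (d : dart G) : face :=
  exist _ (porbit face_perm d) (porbit_faces d).

(* The dual edge of e is e itself, so subsets of E and E* are both subsets of
   [edge G], and [ends_once f e] in the dual says that e occurs exactly once in
   the boundary of f. *)
Definition dual : graph := @Graph face (edge G) face_of.

Definition euler_char : int :=
  #|vertex G|%:Z - #|edge G|%:Z + #|face|%:Z.

Definition move : rel (bicoloring G) := fun c c' =>
  [exists x : vertex G, c' == switch x c] ||
  [exists f : vertex dual, c' == switch f c].

Definition color_classes : {set {set bicoloring G}} :=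
  equivalence_partition (connect move) [set: bicoloring G].

(* Half-arcs of the medial graph: (d, true) is the half, next to the midpoint of
   the edge of d, of the arc at the corner between d and rot d, and (d, false)
   that of the arc at the corner between rot^-1 d and d. *)
Definition half_arc : finType := (dart G * bool)%type.

Definition other_half (h : half_arc) : half_arc :=
  if h.2 then (rot R h.1, false) else ((rot R)^-1%g h.1, true).

(* Counterclockwise rotation of the four half-arcs around a midpoint. *)
Definition medial_rot (h : half_arc) : half_arc :=
  if h.2 then (h.1, false) else (rev h.1, true).

Definition opposite (h : half_arc) : half_arc := medial_rot (medial_rot h).

Definition straight : rel half_arc := fun h h' =>
  (h' == other_half h) || (h' == opposite h).

(* For the graph without edges, the single circle has the zero vector, hence it
   can be left out here. *)
Definition medial_components : {set {set half_arc}} :=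
  equivalence_partition (connect straight) [set: half_arc].

(* The two strands through the midpoint of e are {((e, b), s) | b : bool} for
   s = true and s = false. *)
Definition passes (K : {set half_arc}) (e : edge G) : nat :=
  #|[set s : bool | ((e, false), s) \in K]|.

Definition component_vec (K : {set half_arc}) : edge_space G :=
  [ffun e => (passes K e)%:R].

Definition medial_space : {vspace edge_space G} :=
  <<[seq component_vec K | K in medial_components]>>%VS.

Definition homology_map (n : nat) (p : 'I_n -> {set edge G}) :
    'Hom(subvs_of (cycle_space G), 'rV['F_2]_n) :=
  linfun (fun u : subvs_of (cycle_space G) =>
            \row_j dot (char_vec (p j)) (vsval u)).

(* The kernel of the restriction of phi to the part of P in its domain; the
   medial space P is in fact contained in the cycle space. *)
Definition ker_on_medial (n : nat)
    (phi : 'Hom(subvs_of (cycle_space G), 'rV['F_2]_n)) :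
    {vspace subvs_of (cycle_space G)} :=
  (linfun vsval @^-1: medial_space :&: lker phi)%VS.

End Embedding.

(* Main.v *)
(* Let U and D be the cocycle spaces of G and of its dual.  Two bicolorings are
   equivalent exactly when they differ by an element of U + D, so there are
   2^(|E| - dim (U + D)) classes; as dim U = |V| - 1 and dim D = |F| - 1, Euler's
   formula turns the exponent into 2g + dim (U :&: D).  A cycle of G is
   null-homologous exactly when it lies in D, because the p_j together with U
   span the orthogonal of D: they are orthogonal to D, and independent modulo U
   since a coboundary vanishing on the spanning tree T is zero.  Hence b is the
   dimension of P :&: D, and P :&: D = U :&: D: a function of the vertex plus a
   function of the face, seen on the corners, is constant along the medial
   curves when both have the same coboundary, and conversely subtracting the
   face potential from a function constant along the medial curves leaves a
   function of the vertex. *)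
Require Import Defs.
From mathcomp Require Import all_boot all_order all_fingroup all_algebra.
From HB Require Import structures.
From mathcomp Require Import finfield zify.

Set Implicit Arguments.
Unset Strict Implicit.
Unset Printing Implicit Defensive.

Import GRing.Theory.
Local Open Scope ring_scope.
Local Notation rev := Defs.rev.
Local Notation rot := Defs.rot.

(** * Arithmetic in GF(2) and function spaces over it *)

Lemma addrr_F2 (a : 'F_2) : a + a = 0.
Proof. by rewrite addrr_pchar2 // pchar_Fp. Qed.

Lemma addr_eq0_F2 (a b : 'F_2) : a + b = 0 -> a = b.
Proof. by move=> ab0; rewrite -[RHS]add0r -ab0 -addrA addrr_F2 addr0. Qed.

Lemma F2_eq_natr (a : 'F_2) : a = (a != 0)%:R.
Proof. by case: a => [[|[|[]]]] // i; apply: val_inj. Qed.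

Lemma natr_addb (a b : bool) : (a (+) b)%:R = a%:R + b%:R :> 'F_2.
Proof. by case: a b => [] []; apply: val_inj. Qed.

Lemma natr_b_inj : injective (fun b : bool => b%:R : 'F_2).
Proof. by case=> [] [] // /eqP. Qed.

Lemma card_vspace_F2 (I : finType) (V : {vspace {ffun I -> ('F_2)^o}}) :
  #|V| = (2 ^ \dim V)%N.
Proof. by rewrite card_vspace card_Fp. Qed.

Lemma dim_ffun_F2 (I : finType) : \dim {: {ffun I -> ('F_2)^o}} = #|I|.
Proof.
(* The dimension is read off from the number of functions, $2^{|I|}$. *)
apply/eqP; rewrite -(eqn_exp2l (m := 2)) // -card_vspace_F2.
rewrite -[X in (X ^ _)%N](card_Fp (p := 2)) // -card_ffun; apply/eqP.
by apply: eq_card => v; rewrite memvf.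
Qed.

Definition delta (I : finType) (i : I) : {ffun I -> ('F_2)^o} :=
  [ffun j => (j == i)%:R].

Lemma ffun_delta (I : finType) (x : {ffun I -> ('F_2)^o}) :
  x = \sum_i x i *: delta i.
Proof.
apply/ffunP=> j; rewrite sum_ffunE (bigD1 j) //= big1 => [|i /negPf ij].
  by rewrite !ffunE eqxx addr0; exact/esym/mulr1.
by rewrite !ffunE eq_sym ij; exact: mulr0.
Qed.

(** * The standard inner product and orthogonal complements *)

Lemma dot_is_linear (G : graph) (u : edge_space G) :
  linear (dot u : edge_space G -> ('F_2)^o).
Proof.
move=> a v w; rewrite /dot scaler_sumr -big_split /=.
by apply: eq_bigr => e _; rewrite !ffunE mulrDr mulrCA.
Qed.
HB.instance Definition _ (G : graph) (u : edge_space G) :=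
  GRing.isLinear.Build _ (edge_space G) ('F_2)^o _ (dot u) (dot_is_linear u).

Lemma dotC (G : graph) (u v : edge_space G) : dot u v = dot v u.
Proof. by apply: eq_bigr => e _; rewrite mulrC. Qed.

Lemma orthvP (G : graph) (U : {vspace edge_space G}) (u : edge_space G) :
  reflect (forall w, w \in U -> dot w u = 0) (u \in orthv U).
Proof.
rewrite memvE; apply: (iffP subv_bigcapP) => /= Uu w Uw;
  have := Uu w Uw; rewrite -memvE memv_ker lfunE /=; first by move/eqP.
by move=> ->.
Qed.

Lemma dot_eq0 (G : graph) (u : edge_space G) : (forall w, dot w u = 0) -> u = 0.
Proof.
move=> u0; apply/ffunP=> e; rewrite ffunE -(u0 (delta e)).
rewrite /dot (bigD1 e) //= ffunE eqxx mul1r big1 ?addr0 // => e' /negPf ne'.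
by rewrite ffunE ne' mul0r.
Qed.

(* Pairing with a basis of a complement of [orthv W] is injective on [W]. *)
Lemma dim_orthv (G : graph) (W : {vspace edge_space G}) :
  (\dim W + \dim (orthv W) <= #|edge G|)%N.
Proof.
set X := ((orthv W)^C)%VS.
pose pairing (w : edge_space G) : {ffun 'I_(\dim X) -> ('F_2)^o} :=
  [ffun i : 'I_(\dim X) => dot w (vbasis X)`_i].
have pairing_linear : linear pairing.
  move=> a v w; apply/ffunP=> i; rewrite !ffunE.
  by rewrite ![dot _ (vbasis X)`_i]dotC (linearP (dot (vbasis X)`_i)).
pose f : {linear edge_space G -> {ffun 'I_(\dim X) -> ('F_2)^o}} :=
  HB.pack pairing (GRing.isLinear.Build _ _ _ _ pairing pairing_linear).
have W0 : (W :&: lker (linfun f) = 0)%VS.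
  apply/eqP; rewrite -subv0; apply/subvP=> w /memv_capP[Ww].
  rewrite memv_ker lfunE memv0 => /eqP/ffunP fw0.
  apply/eqP/dot_eq0 => v; rewrite dotC.
  have: v \in (orthv W + X)%VS by rewrite addv_complf memvf.
  case/memv_addP=> o /orthvP/(_ w Ww) wo [x Xx ->].
  rewrite linearD /= wo add0r (coord_vbasis Xx) linear_sum big1 // => i _.
  by rewrite linearZ /=; have := fw0 i; rewrite !ffunE => ->; rewrite scaler0.
rewrite -(limg_dim_eq W0) addnC -dim_ffun_F2 -leq_subRL ?dimvS ?subvf //.
rewrite -dimv_compl -/X.
by rewrite (leq_trans (dimvS (subvf _))) // dim_ffun_F2 card_ord.
Qed.

(** * Vertex potentials and the cocycle space *)

Definition coboundary (G : graph) (x : {ffun vertex G -> ('F_2)^o}) :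
    edge_space G :=
  [ffun e => x (endpt (e, false)) + x (endpt (e, true))].

Lemma coboundary_is_linear (G : graph) : linear (@coboundary G).
Proof.
by move=> a x y; apply/ffunP=> e; rewrite !ffunE scalerDr addrACA.
Qed.
HB.instance Definition _ (G : graph) :=
  GRing.isLinear.Build _ _ _ _ (@coboundary G) (@coboundary_is_linear G).

Lemma ends_onceE (G : graph) (x : vertex G) (e : edge G) :
  (ends_once x e)%:R =
    (endpt (e, false) == x)%:R + (endpt (e, true) == x)%:R :> 'F_2.
Proof.
rewrite /ends_once -sum1dep_card big_mkcond big_bool /=.
by case: (_ == x); case: (_ == x); apply: val_inj.
Qed.

Lemma incidence_rowE (G : graph) (x : vertex G) :
  incidence_row x = coboundary (delta x).
Proof. by apply/ffunP=> e; rewrite !ffunE ends_onceE. Qed.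

(** The incidence rows are the coboundaries of the vertex indicators, which span all potentials. *)
Lemma cocycleE (G : graph) : cocycle_space G = limg (linfun (@coboundary G)).
Proof.
apply/eqP; rewrite eqEsubv; apply/andP; split.
  apply/span_subvP=> _ /mapP[x _ ->].
  by rewrite incidence_rowE -(lfunE (@coboundary G)) memv_img ?memvf.
apply/subvP=> _ /memv_imgP[x _ ->]; rewrite lfunE /= [x]ffun_delta linear_sum.
apply: memv_suml => i _; rewrite linearZ memvZ //= -incidence_rowE.
by apply/memv_span/map_f; rewrite mem_enum.
Qed.

Lemma cocycleP (G : graph) (u : edge_space G) :
  reflect (exists x, u = coboundary x) (u \in cocycle_space G).
Proof.
rewrite cocycleE; apply: (iffP memv_imgP) => [[x _ ->]|[x ->]]; exists x;
  by rewrite ?lfunE ?memvf.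
Qed.

Lemma coboundaryE (G : graph) (x : {ffun vertex G -> ('F_2)^o}) (d : dart G) :
  coboundary x d.1 = x (endpt d) + x (endpt (rev d)).
Proof. by case: d => e [] /=; rewrite ffunE // addrC. Qed.

Lemma adj_sym (G : graph) (A : {set edge G}) : connect_sym (adj A).
Proof.
apply: sym_connect_sym => x y; apply/existsP/existsP => -[d];
  case/and3P=> dA dx dy; exists (rev d); rewrite dA /= dy;
  by case: d dx {dA dy} => e b; rewrite /rev /= negbK.
Qed.

Lemma n_comp1_connect (G : graph) (A : {set edge G}) (x y : vertex G) :
  n_comp (adj A) (vertex G) = 1%N -> connect (adj A) x y.
Proof.
move=> /eqP/card1P => -[r rP]; rewrite -(root_connect (adj_sym A)).
have r_root z : fingraph.root (adj A) z = r.
  by apply/eqP; rewrite -[_ == _]rP inE roots_root //; apply: adj_sym.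
by rewrite !r_root.
Qed.

(** Across an edge with zero coboundary a potential keeps its value; follow a path in [A]. *)
Lemma coboundary_connect (G : graph) (A : {set edge G}) x :
  n_comp (adj A) (vertex G) = 1%N ->
  {in A, forall e, coboundary x e = 0} -> forall v w, x v = x w.
Proof.
move=> A1 xA v w; have /connectP[s] := n_comp1_connect v w A1.
elim: s v => [|z s IHs] v /=; first by move=> _ ->.
case/andP=> /existsP[d /and3P[dA /eqP <- /eqP dz]] sP ws.
rewrite -(IHs z) // -dz; apply: addr_eq0_F2.
by rewrite -coboundaryE xA.
Qed.

Lemma vertex_of_n_comp1 (G : graph) (A : {set edge G}) :
  n_comp (adj A) (vertex G) = 1%N -> vertex G.
Proof.
move=> A1; case: (pickP (mem (vertex G))) => [v _ //| V0].
suff: n_comp (adj A) (vertex G) = 0%N by rewrite A1.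
by apply: eq_card0 => v; rewrite inE V0 andbF.
Qed.

(** Rank-nullity: by connectedness the potentials with zero coboundary are the constants, a line.
    With [A] a spanning tree, this serves both for the graph and for its dual. *)
Lemma dim_cocycle (G : graph) (A : {set edge G}) :
  n_comp (adj A) (vertex G) = 1%N ->
  (\dim (cocycle_space G)).+1 = #|vertex G|.
Proof.
move=> A1; have v0 := vertex_of_n_comp1 A1.
rewrite cocycleE -dim_ffun_F2 -(limg_ker_dim (linfun (@coboundary G)) fullv).
rewrite -add1n; congr (_ + _)%N.
pose one : {ffun vertex G -> ('F_2)^o} := [ffun => 1].
have -> : (fullv :&: lker (linfun (@coboundary G)) = <[one]>)%VS.
  apply/vspaceP=> x; rewrite capfv memv_ker lfunE /=.
  apply/eqP/vlineP => [x0 | [k ->]].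
    exists (x v0); apply/ffunP=> v; rewrite !ffunE [RHS]mulr1.
    by apply: (coboundary_connect A1) => e _; rewrite x0 ffunE.
  by apply/ffunP=> e; rewrite !ffunE addrr_F2.
rewrite dim_vline; case: eqP => // /ffunP/(_ v0); rewrite !ffunE.
by move/eqP; rewrite oner_eq0.
Qed.

(** * Orthogonality relations between cycles, cocycles and dual cocycles *)

Lemma sum_coboundary (G : graph) (h : edge G -> 'F_2) x :
  \sum_e h e * coboundary x e = \sum_(d : dart G) h d.1 * x (endpt d).
Proof.
transitivity (\sum_e \sum_(b : bool) h e * x (endpt (e, b))).
  by apply: eq_bigr => e _; rewrite big_bool ffunE mulrDr addrC.
by rewrite pair_bigA /=; apply: eq_bigr => -[e b].
Qed.

(** Group the darts of [Z] by vertex: each vertex value is added 0 or 2 times. *)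
Lemma dot_cycle_coboundary (G : graph) (Z : {set edge G}) x :
  is_cycle Z -> dot (char_vec Z) (coboundary x) = 0.
Proof.
case/and3P=> _ /forallP degZ _; rewrite /dot sum_coboundary.
rewrite (partition_big (fun d : dart G => endpt d) predT) //= big1 // => v _.
transitivity (\sum_(d : dart G | (d.1 \in Z) && (endpt d == v)) x v).
  rewrite big_mkcondl; apply: eq_bigr => d /eqP ->; rewrite ffunE.
  by case: (_ \in Z); rewrite ?mul1r ?mul0r.
rewrite sumr_const -cardsE; have := degZ v; rewrite !inE.
by case/orP=> /eqP ->; rewrite ?mulr0n // mulr2n addrr_F2.
Qed.

(** Walking along [rev d] arrives at the vertex of [d], and the next dart of the boundary is
    [rot R d]. *)
Lemma face_of_rot (G : graph) (R : rotation_system G) (d : dart G) :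
  face_of R (rot R d) = face_of R (rev d).
Proof.
apply: val_inj => /=; apply/eqP; rewrite eq_porbit_mem.
have -> : rot R d = face_perm R (rev d).
  by rewrite permM permE /rev /= negbK; case: d.
by rewrite (mem_porbit _ 1).
Qed.

Lemma endpt_rot (G : graph) (R : rotation_system G) (d : dart G) :
  endpt (rot R d) = endpt d.
Proof. by apply/esym/eqP; rewrite (rotP R) (mem_porbit _ 1). Qed.

(* Summing over corners: as [rot] preserves the vertex and carries the face of
   [rev d] to that of [rot d], the corners cancel in pairs. *)
Lemma dot_coboundary_dual (G : graph) (R : rotation_system G) x y :
  dot (@coboundary G x) (@coboundary (dual R) y) = 0.
Proof.
rewrite dotC /dot sum_coboundary.
under eq_bigr => d _ do rewrite (@coboundaryE (dual R) y d) mulrDl.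
rewrite big_split /= (reindex_inj (@perm_inj _ (rot R))) /=.
by under eq_bigr => d _ do rewrite endpt_rot face_of_rot; rewrite addrr_F2.
Qed.

(** * Medial curves and the medial space *)

Lemma other_halfK (G : graph) (R : rotation_system G) :
  involutive (other_half R).
Proof. by case=> d [] /=; rewrite /other_half /= ?permK ?permKV. Qed.

Lemma oppositeE (G : graph) (d : dart G) (s : bool) :
  opposite (d, s) = (rev d, s).
Proof. by case: s. Qed.

Lemma straight_sym (G : graph) (R : rotation_system G) :
  connect_sym (straight R).
Proof.
apply: sym_connect_sym => h h'; rewrite /straight; congr (_ || _).
  by apply/eqP/eqP => ->; rewrite other_halfK.
by case: h h' => [[e b] s] [[e' b'] s']; rewrite !oppositeE /rev /=;
  apply/eqP/eqP => -[-> -> ->]; rewrite negbK.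
Qed.

Lemma medial_partition (G : graph) (R : rotation_system G) :
  partition (medial_components R) [set: half_arc G].
Proof.
apply/equivalence_partitionP => h h' h'' _ _ _; split; first exact: connect0.
by move=> /(same_connect (straight_sym R)) ->.
Qed.

Lemma passesE (G : graph) (K : {set half_arc G}) (e : edge G) :
  (passes K e)%:R =
    (((e, false), true) \in K)%:R + (((e, false), false) \in K)%:R :> 'F_2.
Proof.
rewrite /passes -sum1dep_card big_mkcond big_bool /=.
by case: (_ \in K); case: (_ \in K); apply: val_inj.
Qed.

Lemma medial_component_straight (G : graph) (R : rotation_system G) K h h' :
  K \in medial_components R -> straight R h h' -> (h \in K) = (h' \in K).
Proof.
case/imsetP=> k _ -> hh'; rewrite !inE /=.
have h_h' := same_connect (straight_sym R) (connect1 hh').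
by rewrite (straight_sym R k) h_h' straight_sym.
Qed.

(** One coefficient per medial curve amounts to a function on half-arcs constant along the curves;
    at an edge, the coefficients of its two strands are added. *)
Lemma medial_spaceP (G : graph) (R : rotation_system G) (u : edge_space G) :
  u \in medial_space R <->
  exists2 z : half_arc G -> 'F_2,
    forall h h', straight R h h' -> z h = z h' &
    forall d : dart G, u d.1 = z (d, true) + z (d, false).
Proof.
split=> [Pu | [z z_straight uz]].
  pose s := enum (medial_components R).
  pose X := in_tuple [seq component_vec K | K <- s].
  have sP (i : 'I_(size [seq component_vec K | K <- s])) :
      nth set0 s i \in medial_components R.
    by rewrite -mem_enum mem_nth // -(size_map (@component_vec G)).
  pose z h : 'F_2 := \sum_i coord X i u * (h \in nth set0 s i)%:R.
  have z_straight h h' : straight R h h' -> z h = z h'.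
    move=> hh'; apply: eq_bigr => i _.
    by rewrite (medial_component_straight (sP i) hh').
  have zrev d b : z (rev d, b) = z (d, b).
    by apply/esym/z_straight; rewrite /straight oppositeE eqxx orbT.
  have uz e : u e = z ((e, false), true) + z ((e, false), false).
    rewrite [in LHS](coord_span (X := X) Pu) sum_ffunE -big_split /=.
    apply: eq_bigr => i _; rewrite -mulrDr -passesE ffunE.
    rewrite (nth_map set0) ?ffunE // -(size_map (@component_vec G)).
    exact: ltn_ord.
  exists z => // -[e []]; rewrite uz //.
  by rewrite -(zrev (e, false) true) -(zrev (e, false) false).
(* The common value of [z] on the curve [K]; the default 0 only concerns the empty set, which is no
   curve. *)
pose zK (K : {set half_arc G}) := if [pick h in K] is Some h then z h else 0.
have z_connect h h' : connect (straight R) h h' -> z h = z h'.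
  case/connectP=> s + ->; elim: s h => //= k s IHs h /andP[hk /IHs <-].
  exact: z_straight.
have [/eqP covP trivP _] := and3P (medial_partition R).
have zKE h : \sum_(K in medial_components R) zK K * (h \in K)%:R = z h.
  have hP : h \in cover (medial_components R) by rewrite covP inE.
  have KP := pblock_mem hP; have hK : h \in pblock (medial_components R) h.
    by rewrite mem_pblock.
  rewrite (bigD1 _ KP) /= big1 => [|K /andP[PK neK]]; last first.
    case hK': (h \in K); last by rewrite mulr0.
    by rewrite (def_pblock trivP PK hK') eqxx in neK.
  rewrite addr0 hK mulr1 /zK; case: pickP => [k |/(_ h)]; last by rewrite hK.
  case/imsetP: KP hK => k0 _ ->; rewrite !inE /= => /z_connect <-.
  by move/z_connect.
have -> : u = \sum_(K in medial_components R)
                (zK K : ('F_2)^o) *: component_vec K.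
  apply/ffunP=> e; rewrite sum_ffunE (uz (e, false)) -!zKE -big_split /=.
  by apply: eq_bigr => K _; rewrite !ffunE -mulrDr -passesE.
apply: memv_suml => K PK; rewrite memvZ //; apply: memv_span.
by apply: map_f; rewrite mem_enum.
Qed.

(** With [u] the dual coboundary of [y], the corner function [z] and the vertex potential [x]
    determine each other: at each corner, [z] is [x] at its vertex plus [y] at its face. *)
Lemma medial_cap_dual (G : graph) (R : rotation_system G) (u : edge_space G) :
  u \in cocycle_space (dual R) ->
  (u \in medial_space R) = (u \in cocycle_space G).
Proof.
case/cocycleP=> y uy.
have uyE (d : dart G) : u d.1 = y (face_of R d) + y (face_of R (rev d)).
  by rewrite uy; apply: (@coboundaryE (dual R) y d).
apply/idP/idP => [/medial_spaceP[z z_straight uz] | /cocycleP[x ux]];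
  last first.
  apply/medial_spaceP.
  (* The corner after [d] lies in the face of [rev d], the corner before [d] in the face of [d]. *)
  exists (fun h => x (endpt h.1) +
                   y (face_of R (if h.2 then rev h.1 else h.1))).
    move=> [d []] h' /orP[] /eqP ->; rewrite ?oppositeE /other_half /=.
    - by rewrite endpt_rot face_of_rot.
    - apply: addr_eq0_F2; rewrite addrACA -(coboundaryE x d) -ux.
      by rewrite -(uyE (rev d)) addrr_F2.
    - by rewrite -(endpt_rot R (_ d)) -face_of_rot permKV.
    - apply: addr_eq0_F2; rewrite addrACA -(coboundaryE x d) -ux.
      by rewrite -(uyE d) addrr_F2.
  by move=> d; rewrite addrACA addrr_F2 add0r /= addrC -uyE.
pose w d : 'F_2 := z (d, false) + y (face_of R d).
(* Between the two corners beside [d], both [z] and the face potential change by [u d.1], so their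
   sum does not change. *)
have w_rot d : w (rot R d) = w d.
  rewrite /w face_of_rot -(z_straight (d, true)); last first.
    by rewrite /straight /other_half /= eqxx.
  apply: addr_eq0_F2; rewrite addrACA -uz [y _ + _]addrC.
  by rewrite -uyE addrr_F2.
have w_vertex d d' : endpt d = endpt d' -> w d = w d'.
  move/eqP; rewrite (rotP R) => /porbitP[n ->].
  by elim: n => [|n IHn]; rewrite ?expg0 ?perm1 // expgSr permM w_rot.
(* A vertex without darts meets no edge, so its value 0 is arbitrary. *)
pose x : {ffun vertex G -> ('F_2)^o} :=
  [ffun v => if [pick d | endpt d == v] is Some d then w d else 0].
have xE d : x (endpt d) = w d.
  by rewrite ffunE; case: pickP => [d' /eqP/w_vertex //|/(_ d)]; rewrite eqxx.
apply/cocycleP; exists x; apply/ffunP=> e.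
have -> : e = (e, false).1 :> edge G by [].
rewrite coboundaryE !xE /w addrACA -uyE.
(* Both [z] terms lie on one strand through the midpoint of [e] and cancel, leaving the face
   potentials. *)
rewrite -(z_straight ((e, false), false) (rev (e, false), false)).
  by rewrite addrr_F2 add0r.
by rewrite /straight oppositeE eqxx orbT.
Qed.

(** * Equivalence classes of bicolorings as cosets *)

Definition color_vec (G : graph) (c : bicoloring G) : edge_space G :=
  [ffun e => (c e)%:R].

Lemma color_vec_inj (G : graph) : injective (@color_vec G).
Proof.
by move=> c c' /ffunP cc'; apply/ffunP=> e; have := cc' e;
  rewrite !ffunE => /natr_b_inj.
Qed.

Lemma color_vec_switch (G : graph) (x : vertex G) (c : bicoloring G) :
  color_vec (switch x c) = color_vec c + incidence_row x.
Proof. by apply/ffunP=> e; rewrite !ffunE natr_addb. Qed.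

(** Switch once at each vertex of the support of [x]. The relation [r] is left general so that this
    covers vertex moves and, on the dual, face moves. *)
Lemma connect_coboundary (G : graph) (r : rel (bicoloring G)) x c c' :
  (forall v k, r k (switch v k)) ->
  color_vec c' = color_vec c + coboundary x -> connect r c c'.
Proof.
move=> r_switch c'E.
pose k (s : seq (vertex G)) := foldr (fun v => switch v) c s.
have kE s : color_vec (k s) = color_vec c + \sum_(v <- s) incidence_row v.
  elim: s => [|v s IHs] /=; first by rewrite big_nil addr0.
  by rewrite color_vec_switch IHs big_cons -addrA [X in _ + X]addrC.
have -> : c' = k [seq v <- enum (vertex G) | x v != 0].
  apply: color_vec_inj; rewrite kE c'E big_filter big_enum_cond /=.
  congr (_ + _); rewrite {1}[x]ffun_delta linear_sum [RHS]big_mkcond /=.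
  apply: eq_bigr => v _; rewrite linearZ /= -incidence_rowE.
  by rewrite (F2_eq_natr (x v)); case: (x v != 0); rewrite ?scale1r ?scale0r.
elim: (filter _ _) => //= v s IHs.
by apply: connect_trans IHs (connect1 _).
Qed.

Definition move_space (G : graph) (R : rotation_system G) :
    {vspace edge_space G} :=
  (cocycle_space G + (cocycle_space (dual R) : {vspace edge_space G}))%VS.

Lemma addvv_F2 (G : graph) (u : edge_space G) : u + u = 0.
Proof. by apply/ffunP=> e; rewrite !ffunE addrr_F2. Qed.

Lemma connect_moveE (G : graph) (R : rotation_system G) c c' :
  connect (move R) c c' = (color_vec c + color_vec c' \in move_space R).
Proof.
apply/idP/idP => [/connectP[s + ->] {c'}|].
  elim: s c => [|k s IHs] c /=; first by rewrite addvv_F2 mem0v.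
  case/andP=> ck /IHs; set l := last _ _ => kl.
  have -> : color_vec c + color_vec l =
      (color_vec c + color_vec k) + (color_vec k + color_vec l).
    by rewrite -addrA (addrA (color_vec k)) addvv_F2 add0r.
  rewrite memvD {kl}//.
  case/orP: ck => /existsP[v /eqP ->].
    rewrite color_vec_switch addrA addvv_F2 add0r.
    by rewrite (subvP (addvSl _ _)) // memv_span // map_f ?mem_enum.
  have -> : @color_vec G (switch v c) = @color_vec G c + incidence_row v.
    exact: (@color_vec_switch (dual R) v c).
  rewrite addrA addvv_F2 add0r.
  by rewrite (subvP (addvSr _ _)) // memv_span // map_f ?mem_enum.
case/memv_addP=> a /cocycleP[x ->] [b /(@cocycleP (dual R) _)[y ->] cc'].
(* The coloring reached after all vertex moves and before the face moves. *)
pose k : bicoloring G := [ffun e => (color_vec c + coboundary x) e != 0].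
have kE : color_vec k = color_vec c + coboundary x.
  by apply/ffunP=> e; rewrite !ffunE -F2_eq_natr.
apply: (connect_trans (y := k)).
  apply: connect_coboundary kE => v d; apply/orP; left.
  by apply/existsP; exists v.
apply: (@connect_coboundary (dual R) _ y) => [v d|].
  by apply/orP; right; apply/existsP; exists v.
rewrite -[LHS]add0r -(addvv_F2 (color_vec c)) -addrA cc' addrA.
by congr (_ + _); rewrite -kE.
Qed.

(** Adding [color_vec c] carries the class of [c] bijectively onto [move_space R], so all classes
    have the same size. *)
Lemma card_color_classes (G : graph) (R : rotation_system G) :
  (#|color_classes R| * 2 ^ \dim (move_space R) = 2 ^ #|edge G|)%N.
Proof.
have move_equiv : {in [set: bicoloring G] & &,
    equivalence_rel (connect (move R))}.
  move=> c c' c'' _ _ _; split; first exact: connect0.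
  rewrite !connect_moveE => cc'; apply/idP/idP=> h; have := memvD cc' h.
    by rewrite addrACA addvv_F2 add0r.
  by rewrite -addrA (addrA (color_vec c')) addvv_F2 add0r.
have := card_uniform_partition _ (equivalence_partitionP move_equiv).
move=> /(_ (2 ^ \dim (move_space R))%N) <-.
  by rewrite cardsT card_ffun card_bool.
move=> _ /imsetP[c _ ->].
have shift_inj : injective (fun c' => color_vec c + color_vec c').
  by move=> c1 c2 /addrI /color_vec_inj.
rewrite -(card_imset _ shift_inj) -card_vspace_F2.
apply: eq_card => u; apply/imsetP/idP => [[c' + ->]|Wu].
  by case/setIdP=> _; rewrite connect_moveE.
pose c' : bicoloring G := [ffun e => (color_vec c + u) e != 0].
have c'E : color_vec c + color_vec c' = u.
  have -> : color_vec c' = color_vec c + u.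
    by apply/ffunP=> e; rewrite !ffunE -F2_eq_natr.
  by rewrite addrA addvv_F2 add0r.
by exists c'; rewrite ?inE /= ?connect_moveE c'E.
Qed.

(** * Dimension count by Euler's formula *)

Lemma dim_move_space (G : graph) (R : rotation_system G) (n : nat)
    (A B : {set edge G}) :
  euler_char R = 2%:Z - n%:Z ->
  n_comp (adj A) (vertex G) = 1%N ->
  n_comp (@adj (dual R) B) (vertex (dual R)) = 1%N ->
  (\dim (move_space R) + n +
   \dim (cocycle_space G :&: (cocycle_space (dual R) : {vspace edge_space G}))
   = #|edge G|)%N.
Proof.
rewrite /euler_char => euler_n /dim_cocycle dimU /dim_cocycle dimD.
rewrite -[#|vertex _|]/#|face R| in dimD.
(* The dimensions of sum and intersection add up to $|V|+|F|-2$, which is $|E|-n$ by Euler's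
   formula. *)
have := dimv_sum_cap (cocycle_space G)
  (cocycle_space (dual R) : {vspace edge_space G}).
rewrite -/(move_space R); set cap := (_ :&: _)%VS; move: dimU dimD.
move: (\dim (cocycle_space G)) (\dim (cocycle_space (dual R))) => d1 d2.
by move: (\dim (move_space R)) (\dim cap) => d3 d4; lia.
Qed.

(** * The dual cycles $p_j$ and the kernel of the homology map *)

Definition cycle_comb (G : graph) (n : nat) (p : 'I_n -> {set edge G})
    (a : {ffun 'I_n -> ('F_2)^o}) : edge_space G :=
  \sum_j a j *: char_vec (p j).

Lemma cycle_comb_is_linear (G : graph) (n : nat) (p : 'I_n -> {set edge G}) :
  linear (cycle_comb p).
Proof.
move=> k a b; rewrite /cycle_comb scaler_sumr -big_split /=.
by apply: eq_bigr => j _; rewrite !ffunE scalerDl scalerA.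
Qed.
HB.instance Definition _ (G : graph) (n : nat) (p : 'I_n -> {set edge G}) :=
  GRing.isLinear.Build _ _ _ _ (cycle_comb p) (cycle_comb_is_linear p).

Section Homology.
Variables (G : graph) (R : rotation_system G) (n : nat).
Variables (T C : {set edge G}) (e : 'I_n -> edge G) (p : 'I_n -> {set edge G}).
Hypotheses (euler_n : euler_char R = 2%:Z - n%:Z).
Hypotheses (T_tree : spanning_tree T) (C_tree : @spanning_tree (dual R) C).
Hypotheses (T_C : [disjoint T & C]) (e_inj : injective e).
Hypothesis e_rest : [set e j | j : 'I_n] = ~: (T :|: C).
Hypothesis p_cycle : forall j, @is_cycle (dual R) (p j) /\ p j \subset e j |: C.

Let T_connected : n_comp (adj T) (vertex G) = 1%N.
Proof. by case/andP: T_tree => /eqP. Qed.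

Let C_connected : n_comp (@adj (dual R) C) (vertex (dual R)) = 1%N.
Proof. by case/andP: C_tree => /eqP. Qed.

Let eTC j : (e j \notin T) && (e j \notin C).
Proof.
have: e j \in ~: (T :|: C) by rewrite -e_rest imset_f.
by rewrite !inE negb_or.
Qed.

(** Without [e j], the cycle [p j] would lie in the tree [C]; every other [e i] is outside [C] and
    differs from [e j]. *)
Let e_in_p i j : (e i \in p j) = (i == j).
Proof.
have [cyc_p sub_p] := p_cycle j; have [-> | ne_ij] := eqVneq i j.
  apply: contraLR cyc_p => ej; case/andP: C_tree => _ /forallP/(_ (p j)).
  move/implyP; apply; apply/subsetP=> f fp.
  have := subsetP sub_p f fp; rewrite !inE.
  by case/orP=> // /eqP fe; rewrite -fe fp in ej.
apply: contraNF ne_ij => /(subsetP sub_p).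
by have /andP[_ /negPf eC] := eTC i; rewrite !inE eC orbF (inj_eq e_inj).
Qed.

Let p_T j f : f \in T -> f \notin p j.
Proof.
have [_ sub_p] := p_cycle j => fT; apply/negP => /(subsetP sub_p).
rewrite !inE (disjointFr T_C fT) orbF => /eqP fe.
by have := eTC j; rewrite -fe fT.
Qed.

Let dot_p_dual j y :
  dot (char_vec (p j) : edge_space G) (@coboundary (dual R) y) = 0.
Proof. exact: (@dot_cycle_coboundary (dual R) _ _ (proj1 (p_cycle j))). Qed.

(** The combination avoids [T], so its potential is constant and it vanishes; its value at [e j] is
    the coefficient [a j]. *)
Let comb_cocycle a : cycle_comb p a \in cocycle_space G -> a = 0.
Proof.
case/cocycleP=> x ax.
have x_const : forall v w, x v = x w.
  apply: (coboundary_connect T_connected) => f fT.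
  rewrite -ax sum_ffunE big1 // => j _.
  by rewrite !ffunE (negPf (p_T _ fT)) scaler0.
apply/ffunP=> j; have /ffunP/(_ (e j)) := ax.
rewrite sum_ffunE (bigD1 j) //= big1 => [|i /negPf ne_ij].
  rewrite !ffunE e_in_p eqxx addr0 (x_const _ (endpt (e j, true))) addrr_F2.
  by move=> <-; apply/esym/mulr1.
by rewrite !ffunE e_in_p eq_sym ne_ij scaler0.
Qed.

(** Dual cocycles are orthogonal to both summands. Equality follows by dimension: the sum has
    dimension $|V|-1+n$, so its orthogonal has at most $|E|-|V|+1-n=|F|-1$. *)
Lemma orthv_cycles :
  (orthv (cocycle_space G + limg (linfun (cycle_comb p))) =
   cocycle_space (dual R) :> {vspace edge_space G})%VS.
Proof.
set W := (_ + _)%VS.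
apply/esym/eqP; rewrite eqEdim; apply/andP; split.
  apply/subvP=> u /(@cocycleP (dual R) _)[y ->]; apply/orthvP.
  move=> _ /memv_addP[_ /cocycleP[x ->] [_ /memv_imgP[a _ ->] ->]].
  rewrite lfunE /= dotC linearD /= dotC dot_coboundary_dual add0r linear_sum.
  rewrite big1 // => j _; rewrite linearZ /= dotC.
  by rewrite dot_p_dual scaler0.
have dimW : \dim W = (\dim (cocycle_space G) + n)%N.
  have comb0 : (fullv :&: lker (linfun (cycle_comb p)) = 0)%VS.
    apply/eqP; rewrite capfv -subv0; apply/subvP=> a.
    rewrite memv_ker lfunE memv0 => /eqP a0; apply/eqP/comb_cocycle.
    by rewrite a0 mem0v.
  rewrite dimv_disjoint_sum ?(limg_dim_eq comb0) ?dim_ffun_F2 ?card_ord //.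
  apply/eqP; rewrite -subv0; apply/subvP=> u /memv_capP[Uu /memv_imgP[a _ ua]].
  rewrite ua lfunE /= in Uu *; rewrite (comb_cocycle Uu).
  by rewrite linear0 mem0v.
have := dim_orthv W; rewrite dimW.
have := dim_cocycle T_connected; have := dim_cocycle C_connected.
move: euler_n; rewrite /euler_char; move: (\dim (orthv W)).
move: (\dim (cocycle_space G)) (\dim (cocycle_space (dual R))).
move=> /= d1 d2 d3; lia.
Qed.

Lemma dim_ker_on_medial :
  \dim (ker_on_medial R (homology_map p)) =
  \dim (cocycle_space G :&: (cocycle_space (dual R) : {vspace edge_space G})).
Proof.
set K := ker_on_medial _ _.
(* Since [vsval] is injective, the dimension can be computed on the image in the edge space. *)
have K0 : (K :&: lker (linfun (vsval : subvs_of (cycle_space G) -> _)) = 0)%VS.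
  apply/eqP; rewrite -subv0; apply/subvP=> u /memv_capP[_].
  rewrite memv_ker lfunE memv0 => /eqP u0; apply/eqP/val_inj.
  by rewrite /= u0.
(* [linfun] agrees with the given function only once that function is known to be linear. *)
have homologyE (u : subvs_of (cycle_space G)) :
    homology_map p u = \row_j dot (char_vec (p j)) (vsval u).
  pose row_p (v : subvs_of (cycle_space G)) : 'rV['F_2]_n :=
    \row_j dot (char_vec (p j)) (vsval v).
  have row_linear : linear row_p.
    by move=> k v w; apply/rowP=> j; rewrite !mxE linearP.
  pose row_pL : {linear subvs_of (cycle_space G) -> 'rV['F_2]_n} :=
    HB.pack row_p (GRing.isLinear.Build _ _ _ _ row_p row_linear).
  exact: (lfunE row_pL).
rewrite -(limg_dim_eq K0); congr (\dim _); apply/vspaceP=> u.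
apply/memv_imgP/memv_capP => [[v + ->] | [Uu Du]].
  rewrite lfunE => /memv_capP[]; rewrite -memv_preim lfunE /= => Pv.
  rewrite memv_ker homologyE => /eqP/rowP pv.
  have Dv : vsval v \in cocycle_space (dual R).
    rewrite -orthv_cycles; apply/orthvP => _ /memv_addP[a Ua [b + ->]].
    case/memv_imgP=> k _ ->; rewrite lfunE /= dotC linearD /= dotC.
    have /orthvP/(_ a Ua) -> := subvsP v; rewrite add0r linear_sum.
    rewrite big1 // => j _; rewrite linearZ /= dotC.
    by have := pv j; rewrite !mxE => ->; rewrite scaler0.
  by split; rewrite // -(medial_cap_dual Dv).
(* Membership in the cycle space is what lifts [u] to the domain of the homology map. *)
have cyc_u : u \in cycle_space G.
  apply/orthvP => _ /cocycleP[x ->]; case/(@cocycleP (dual R) _): Du => y ->.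
  exact: dot_coboundary_dual.
exists (Subvs cyc_u); last by rewrite lfunE.
apply/memv_capP; rewrite -memv_preim lfunE /= medial_cap_dual //; split=> //.
rewrite memv_ker homologyE; apply/eqP/rowP=> j; rewrite !mxE /=.
case/(@cocycleP (dual R) _): Du => y ->.
exact: dot_p_dual.
Qed.

End Homology.

Theorem theorem5p2 (G : graph) (R : rotation_system G) (g : nat)
    (T C : {set edge G})
    (e : 'I_(2 * g) -> edge G) (p : 'I_(2 * g) -> {set edge G})
    (G_connected : connected G)
    (genus_g : euler_char R = 2%:Z - (2 * g)%N%:Z)
    (T_tree : @spanning_tree G T)
    (C_tree : @spanning_tree (dual R) C)
    (T_C_disjoint : [disjoint T & C])
    (e_inj : injective e)
    (e_rest : [set e j | j : 'I_(2 * g)] = ~: (T :|: C))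
    (p_cycle : forall j, @is_cycle (dual R) (p j) /\ p j \subset e j |: C) :
  let b := \dim (ker_on_medial R (homology_map p)) in
  #|color_classes R| = (2 ^ (2 * g + b))%N.
Proof.
move=> b.
have -> : b = \dim (cocycle_space G :&:
    (cocycle_space (dual R) : {vspace edge_space G})).
  exact: (dim_ker_on_medial
    genus_g T_tree C_tree T_C_disjoint e_inj e_rest p_cycle).
have /andP[/eqP T1 _] := T_tree; have /andP[/eqP C1 _] := C_tree.
(* Multiplying by the common class size reduces the claim to an identity of exponents of 2. *)
apply/eqP; rewrite -(@eqn_pmul2r (2 ^ \dim (move_space R))) ?expn_gt0 //.
rewrite card_color_classes -expnD -(dim_move_space genus_g T1 C1).
by rewrite -addnA addnC.
Qed.
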